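(* Let $N,M\ge 1$ be integers and let $\mathbf x^1,\dots,\mathbf x^M,\mathbf y^1,\dots,\mathbf y^M\in\mathbb R^N$. Let $\mathbf X=[\mathbf x^1\,\cdots\,\mathbf x^M]\in\mathbb R^{N\times M}$ and $\mathbf Y=[\mathbf y^1\,\cdots\,\mathbf y^M]\in\mathbb R^{N\times M}$. Let $\mathbf A\in\mathbb R^{N\times N}$ be the standard DMD matrix and let $(\mathbf A_{\mathrm g},\mathbf b)\in\mathbb R^{N\times N}\times\mathbb R^N$ be the generalized DMD (gDMD) pair of the data $(\mathbf X,\mathbf Y)$. Then $$\frac1M\sum_{k=1}^M\|\mathbf y^k-\mathbf A_{\mathrm g}\mathbf x^k-\mathbf b\|^2\;\le\;\frac1M\sum_{k=1}^M\|\mathbf y^k-\mathbf A\mathbf x^k\|^2 .$$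
   Context: $\|\cdot\|$ is the Euclidean norm on $\mathbb R^N$ and $\dagger$ denotes the Moore–Penrose inverse. Standard DMD: $\mathbf A=\mathbf Y\mathbf X^\dagger$, which is a minimizer of $\hat{\mathbf A}\mapsto\frac1M\sum_{k=1}^M\|\mathbf y^k-\hat{\mathbf A}\mathbf x^k\|^2$ over $\hat{\mathbf A}\in\mathbb R^{N\times N}$. Generalized DMD (gDMD): $[\mathbf A_{\mathrm g},\mathbf b]=\mathbf Y\tilde{\mathbf X}^\dagger$, where $\tilde{\mathbf X}=\begin{bmatrix}\mathbf X\\ \mathbf 1\end{bmatrix}\in\mathbb R^{(N+1)\times M}$ and $\mathbf 1=[1,1,\dots,1]$ is the $1\times M$ row of ones; $\mathbf A_{\mathrm g}$ consists of the first $N$ columns of this $N\times(N+1)$ matrix and $\mathbf b$ is its last column. The pair $(\mathbf A_{\mathrm g},\mathbf b)$ is a minimizer of $(\hat{\mathbf A},\hat{\mathbf b})\mapsto\frac1M\sum_{k=1}^M\|\mathbf y^k-\hat{\mathbf A}\mathbf x^k-\hat{\mathbf b}\|^2$ over $\mathbb R^{N\times N}\times\mathbb R^N$. *)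

(* Defs.v *)
From mathcomp Require Import all_boot all_order all_algebra.
From mathcomp Require Import reals.

Set Implicit Arguments.
Unset Strict Implicit.
Unset Printing Implicit Defensive.

Import Order.TTheory GRing.Theory Num.Theory.
Local Open Scope ring_scope.

(* Over a real field the conjugate transpose of the Penrose conditions is the
   plain transpose. [pinvmx] of mxalgebra satisfies only the first condition in
   general, so it cannot serve as the Moore-Penrose inverse. *)
Definition penrose (R : realFieldType) (m n : nat)
    (A : 'M[R]_(m, n)) (P : 'M[R]_(n, m)) : bool :=
  [&& A *m P *m A == A, P *m A *m P == P,
      (A *m P)^T == A *m P & (P *m A)^T == P *m A].

Lemma mulmx_tr_eq0 (R : realFieldType) (m n : nat) (B : 'M[R]_(m, n)) :
  B *m B^T = 0 -> B = 0.
Proof.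
move=> BB0; apply/matrixP => i j; rewrite mxE.
have := congr1 (fun C : 'M[R]_m => C i i) BB0; rewrite !mxE => s0.
have /psumr_eq0P h : forall k : 'I_n, true -> 0 <= B i k * (B^T) k i.
  by move=> k _; rewrite mxE -expr2 sqr_ge0.
by have := h s0 j isT; rewrite mxE => /eqP; rewrite mulf_eq0 orbb => /eqP.
Qed.

Lemma gram_unitmx (R : realFieldType) (m n : nat) (B : 'M[R]_(m, n)) :
  row_free B -> B *m B^T \in unitmx.
Proof.
move=> fB; rewrite -row_free_unit -kermx_eq0; apply/eqP.
set K := kermx _; have KB : K *m (B *m B^T) = 0 by apply: mulmx_ker.
have : K *m B = 0.
  by apply: mulmx_tr_eq0; rewrite trmx_mul !mulmxA -(mulmxA K) KB mul0mx.
by rewrite -[0](mul0mx _ B) => /(row_free_inj fB).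
Qed.

Lemma penrose_mul (R : realFieldType) (m r n : nat) (C : 'M[R]_(m, r))
    (D : 'M[R]_(r, n)) :
  row_full C -> row_free D -> exists P : 'M[R]_(n, m), penrose (C *m D) P.
Proof.
move=> fC fD.
have uD : D *m D^T \in unitmx by apply: gram_unitmx.
have uC : C^T *m C \in unitmx.
  have := @gram_unitmx R _ _ C^T; rewrite trmxK; apply.
  by rewrite /row_free mxrank_tr.
pose G := invmx (C^T *m C); pose H := invmx (D *m D^T).
have GT : G^T = G by rewrite trmx_inv trmx_mul trmxK.
have HT : H^T = H by rewrite trmx_inv trmx_mul trmxK.
have GE : G *m (C^T *m C) = 1%:M by rewrite mulVmx.
have HE : D *m D^T *m H = 1%:M by rewrite mulmxV.
pose P := D^T *m H *m (G *m C^T).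
have AP : C *m D *m P = C *m G *m C^T.
  rewrite /P -!mulmxA; congr (C *m _).
  by rewrite (mulmxA D) (mulmxA (D *m _)) HE mul1mx.
have PA : P *m (C *m D) = D^T *m H *m D.
  rewrite /P -!mulmxA; congr (_ *m (_ *m _)).
  by rewrite (mulmxA C^T) (mulmxA G) GE mul1mx.
exists P; apply/and4P; split; apply/eqP.
- by rewrite AP -!mulmxA (mulmxA C^T) (mulmxA G) GE mul1mx.
- rewrite PA /P -!mulmxA; congr (_ *m (_ *m _)).
  by rewrite (mulmxA D) (mulmxA (D *m _)) HE mul1mx.
- by rewrite AP !trmx_mul trmxK GT mulmxA.
- by rewrite PA !trmx_mul trmxK HT mulmxA.
Qed.

Lemma penrose_exists (R : realFieldType) (m n : nat) (A : 'M[R]_(m, n)) :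
  exists P : 'M[R]_(n, m), penrose A P.
Proof.
rewrite -{1}(mulmx_base A).
exact: penrose_mul (col_base_full A) (row_base_free A).
Qed.

Lemma penrose_uniq (R : realFieldType) (m n : nat) (A : 'M[R]_(m, n))
    (P Q : 'M[R]_(n, m)) : penrose A P -> penrose A Q -> P = Q.
Proof.
move=> /and4P[/eqP p1 /eqP p2 /eqP p3 /eqP p4].
move=> /and4P[/eqP q1 /eqP q2 /eqP q3 /eqP q4].
have e1 : A *m P = A *m Q.
  rewrite -p3 -{1}q1 -(mulmxA (A *m Q)) trmx_mul p3 q3.
  by rewrite mulmxA p1.
have e2 : P *m A = Q *m A.
  rewrite -p4 -{1}q1 -(mulmxA A) mulmxA trmx_mul p4 q4.
  by rewrite -mulmxA (mulmxA A P) p1.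
by rewrite -p2 -mulmxA e1 mulmxA e2 q2.
Qed.

(* The unique matrix satisfying the four Penrose conditions. *)
Definition moore_penrose (R : realFieldType) (m n : nat) (A : 'M[R]_(m, n)) :
    'M[R]_(n, m) :=
  xchoose (penrose_exists A).

Lemma moore_penroseP (R : realFieldType) (m n : nat) (A : 'M[R]_(m, n)) :
  penrose A (moore_penrose A).
Proof. exact: xchooseP. Qed.

(* The library's norm on matrices is the sup norm. *)
Definition enorm (R : rcfType) (n : nat) (v : 'cV[R]_n) : R :=
  Num.sqrt (\sum_(i < n) v i 0 ^+ 2).

Definition data_mx (R : realFieldType) (n m : nat) (x : 'I_m -> 'cV[R]_n) :
    'M[R]_(n, m) :=
  \matrix_(i < n, k < m) x k i 0.

Definition dmd (R : realFieldType) (n m : nat) (X Y : 'M[R]_(n, m)) :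
    'M[R]_n :=
  Y *m moore_penrose X.

Definition augment (R : realFieldType) (n m : nat) (X : 'M[R]_(n, m)) :
    'M[R]_(n + 1, m) :=
  col_mx X (const_mx 1).

Definition gdmd (R : realFieldType) (n m : nat) (X Y : 'M[R]_(n, m)) :
    'M[R]_(n, n + 1) :=
  Y *m moore_penrose (augment X).

Definition gdmd_A (R : realFieldType) (n m : nat) (X Y : 'M[R]_(n, m)) :
    'M[R]_n :=
  lsubmx (gdmd X Y).

Definition gdmd_b (R : realFieldType) (n m : nat) (X Y : 'M[R]_(n, m)) :
    'cV[R]_n :=
  rsubmx (gdmd X Y).

(* Main.v *)
(** Standard DMD is the affine fit [x |-> A x + 0], i.e. the competitor
    [[A, 0]] in the least-squares problem for the augmented data. The matrix
    [Y Z^+] minimizes [W |-> |Y - W Z|^2] (Frobenius norm), because the residual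
    [Y - Y Z^+ Z] has rows orthogonal to the row space of [Z] and Pythagoras
    applies. *)

Require Import Defs.
From mathcomp Require Import all_boot all_order all_algebra.
From mathcomp Require Import reals.

Import Order.TTheory GRing.Theory Num.Theory.
Local Open Scope ring_scope.

Lemma mxtrace_gram_ge0 (R : realFieldType) (m n : nat) (B : 'M[R]_(m, n)) :
  0 <= \tr (B *m B^T).
Proof.
apply: sumr_ge0 => i _; rewrite mxE; apply: sumr_ge0 => j _.
by rewrite mxE -expr2 sqr_ge0.
Qed.

(** Passes from columnwise errors to the squared Frobenius norm in trace form, where orthogonality
    becomes a matrix product equal to 0. *)
Lemma sum_enorm_col (R : rcfType) (n m : nat) (B : 'M[R]_(n, m)) :
  \sum_(k < m) enorm (col k B) ^+ 2 = \tr (B *m B^T).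
Proof.
rewrite /mxtrace; under [RHS]eq_bigr do rewrite mxE.
rewrite exchange_big; apply: eq_bigr => k _.
rewrite sqr_sqrtr; last by apply: sumr_ge0 => i _; rewrite sqr_ge0.
by apply: eq_bigr => i _; rewrite !mxE expr2.
Qed.

Lemma penrose_least_squares (R : realFieldType) (p m n : nat)
    (Z : 'M[R]_(m, n)) (P : 'M[R]_(n, m)) (Y : 'M[R]_(p, n))
    (W : 'M[R]_(p, m)) :
  penrose Z P ->
  \tr ((Y - Y *m P *m Z) *m (Y - Y *m P *m Z)^T)
    <= \tr ((Y - W *m Z) *m (Y - W *m Z)^T).
Proof.
move=> /and4P[/eqP ZPZ _ _ /eqP PZT].
(* [E] is the optimal residual; [F], the gap between the two fits, has its rows in the row space of
   [Z]. *)
set E := Y - _; pose F := (Y *m P - W) *m Z.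
have -> : Y - W *m Z = E + F by rewrite /E /F mulmxBl addrA subrK.
(* Transpose of [Z P Z = Z], using the symmetry of [P Z]; it makes [E] orthogonal to the rows of
   [Z]. *)
have ZT : P *m Z *m Z^T = Z^T by rewrite -{1}PZT -trmx_mul mulmxA ZPZ.
have EZ : E *m Z^T = 0.
  by rewrite mulmxBl -!mulmxA [P *m (_ *m _)]mulmxA ZT subrr.
have EF : E *m F^T = 0 by rewrite trmx_mul mulmxA EZ mul0mx.
have FE : F *m E^T = 0 by rewrite -[F]trmxK -trmx_mul EF trmx0.
have -> : (E + F) *m (E + F)^T = E *m E^T + F *m F^T.
  by rewrite [(E + F)^T]linearD /= mulmxDl !mulmxDr EF FE addr0 add0r.
by rewrite mxtraceD lerDl mxtrace_gram_ge0.
Qed.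

Lemma col_data_mx (R : realFieldType) (n m : nat) (x : 'I_m -> 'cV[R]_n)
    (k : 'I_m) : col k (data_mx x) = x k.
Proof. by apply/colP => i; rewrite !mxE. Qed.

Theorem theorem3p1 (R : realType) (N M : nat) (hN : (1 <= N)%N) (hM : (1 <= M)%N)
    (x y : 'I_M -> 'cV[R]_N) :
  let X := data_mx x in
  let Y := data_mx y in
  let A := dmd X Y in
  let Ag := gdmd_A X Y in
  let b := gdmd_b X Y in
  M%:R^-1 * \sum_(k < M) enorm (y k - Ag *m x k - b) ^+ 2
    <= M%:R^-1 * \sum_(k < M) enorm (y k - A *m x k) ^+ 2.
Proof.
cbv zeta; set X := data_mx x; set Y := data_mx y.
apply: ler_wpM2l; first by rewrite invr_ge0 ler0n.
have colM p q (B : 'M[R]_(p, q)) (C : 'M_(q, M)) k : col k (B *m C) = B *m col k C.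
  by rewrite !colE mulmxA.
(* The row of ones turns the offset [c] into one more column of coefficients, so a single formula
   covers both models. *)
have resE (B : 'M[R]_N) (c : 'cV[R]_N) k :
    y k - B *m x k - c = col k (Y - row_mx B c *m augment X).
  rewrite mul_row_col linearB /= linearD /= !colM !col_data_mx.
  have -> : col k (const_mx 1 : 'M[R]_(1, M)) = 1%:M.
    by apply/colP => i; rewrite !mxE ord1.
  by rewrite mulmx1 opprD addrA.
under eq_bigr do rewrite resE.
(* Subtracting 0 exhibits standard DMD as the case [c = 0]. *)
under [leRHS]eq_bigr => k _ do rewrite -[y k - _]subr0 resE.
(* [hsubmxK] glues [Ag] and [b] back into [gdmd X Y]. *)
rewrite !sum_enorm_col hsubmxK.
exact/penrose_least_squares/moore_penroseP.
Qed.
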